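(* Let $G$ be an abelian group and let $f:G\to\mathbb{C}$ be a generalized polynomial. Then $f$ is a polynomial if and only if the complex linear space generated by all additive functions belonging to its variety $\tau(f)$ is finite dimensional.
   Context: Let $G$ be an abelian group (no topology), written additively. For $y\in G$ and $f:G\to\mathbb{C}$ let $\Delta_y f(x)=f(x+y)-f(x)$, $x\in G$. A function $f:G\to\mathbb{C}$ is a generalized polynomial if there is a natural number $n$ (with $n=0$ allowed) such that $\Delta_{y_1}\Delta_{y_2}\cdots\Delta_{y_{n+1}}f=0$ for all $y_1,\dots,y_{n+1}\in G$. An additive function on $G$ is a homomorphism from $G$ to the additive group of $\mathbb{C}$, i.e. $a:G\to\mathbb{C}$ with $a(x+y)=a(x)+a(y)$ for all $x,y\in G$. A polynomial on $G$ is a function belonging to the function algebra generated by the additive functions and the constants, i.e. a function of the form $p(x)=P(a_1(x),\dots,a_n(x))$ with additive functions $a_1,\dots,a_n:G\to\mathbb{C}$ and an ordinary complex polynomial $P:\mathbb{C}^n\to\mathbb{C}$. For $f:G\to\mathbb{C}$, $\tau(f)$ denotes the variety generated by $f$ (the variety of $f$): the smallest translation invariant complex linear subspace of the space of all functions $G\to\mathbb{C}$ that is closed in the topology of pointwise convergence and contains $f$. *)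

(* Defs.v *)
From HB Require Import structures.
From mathcomp Require Import all_boot all_order all_algebra.
From mathcomp Require Import complex.
From mathcomp Require Import all_classical all_reals all_analysis.
(* mpoly's notations clash with those of MathComp-Analysis. *)
From mathcomp Require mpoly.

Set Implicit Arguments.
Unset Strict Implicit.
Unset Printing Implicit Defensive.

Import Order.TTheory GRing.Theory Num.Theory.

Local Open Scope classical_set_scope.
Local Open Scope ring_scope.

(* The definitions are stated over a numFieldType K, to be instantiated with
   K := R[i] for R : realType. Functions take values in K^o, which is K both as
   a vector space over itself and as a topological space for the distance
   `|x - y|; G -> K^o is then an lmodType K with pointwise operations. *)

Definition difference (G : zmodType) (K : numFieldType) (y : G)
    (f : G -> K^o) : G -> K^o :=
  fun x => f (x + y) - f x.

Definition generalized_polynomial (G : zmodType) (K : numFieldType)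
    (f : G -> K^o) : Prop :=
  exists n : nat, forall ys : n.+1.-tuple G,
    foldr (@difference G K) f ys = (fun=> 0).

Definition additive_function (G : zmodType) (K : numFieldType)
    (a : G -> K^o) : Prop :=
  {morph a : x y / x + y}.

Definition polynomial_function (G : zmodType) (K : numFieldType)
    (f : G -> K^o) : Prop :=
  exists (n : nat) (a : 'I_n -> G -> K^o) (P : mpoly.mpoly n K),
    (forall i, additive_function (a i)) /\
    (forall x, f x = mpoly.meval (fun i => a i x) P).

Definition linear_subspace (K : numFieldType) (V : lmodType K)
    (L : set V) : Prop :=
  L 0 /\ forall (c : K) (u v : V), L u -> L v -> L (c *: u + v).

Definition linear_span (K : numFieldType) (V : lmodType K)
    (A : set V) : set V :=
  smallest (@linear_subspace K V) A.

Definition finite_dimensional (K : numFieldType) (V : lmodType K)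
    (L : set V) : Prop :=
  exists (n : nat) (b : 'I_n -> V),
    L = [set \sum_(i < n) c i *: b i | c in [set: 'I_n -> K]].

Definition translation_invariant (G : zmodType) (K : numFieldType)
    (V : set (G -> K^o)) : Prop :=
  forall (y : G) (g : G -> K^o), V g -> V (fun x => g (x + y)).

Definition is_variety (G : zmodType) (K : numFieldType)
    (V : set (G -> K^o)) : Prop :=
  [/\ linear_subspace V, translation_invariant V
    & closed (V : set {ptws G -> K^o})].

Definition variety_of (G : zmodType) (K : numFieldType)
    (f : G -> K^o) : set (G -> K^o) :=
  smallest (@is_variety G K) [set f].

(* Main.v *)
Require Import Defs.
From mathcomp Require Import all_boot all_order all_algebra.
From mathcomp Require Import ring.
From mathcomp Require Import complex.
From mathcomp Require Import all_classical all_reals all_analysis.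
From mathcomp Require mpoly.

Set Implicit Arguments.
Unset Strict Implicit.
Unset Printing Implicit Defensive.

Import Order.TTheory GRing.Theory Num.Theory.
Import numFieldNormedType.Exports.
Import (canonicals) mpoly.

Local Open Scope classical_set_scope.
Local Open Scope ring_scope.
Local Open Scope complex_scope.

(** Write D_y for the difference operator and A for the space of additive
functions in the variety of f.

Finite dimensionality is handled through evaluations: a space V of functions
is finite dimensional exactly when finitely many points separate its elements
([determined_on]).  For a subspace such points give coordinates, that is
points x_i and functions e_i in V with g = sum_i g(x_i) e_i for all g in V
([determined_coordinates]).

The bridge between the two sides is the existence of an addition formula
f(x + y) = sum_i u_i(x) v_i(y), which says that the translates of f span a
finite dimensional space.

If f is a polynomial, it has an addition formula, because additive functions
and constants do and because addition formulas can be added and multiplied.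
The functions all of whose translates lie in the span of the u_i then form a
finite dimensional variety containing f ([addition_formula_variety]), so the
variety of f, and with it A, is finite dimensional.

Conversely let V be a translation invariant space of functions whose additive
elements have coordinates (x_i, a_i); if A is finite dimensional, this applies
to the variety of f.  If g in V has degree at most 1, then g - g(0) is additive
and lies in V: this is clear if it vanishes, and otherwise V contains the
constants, which are multiples of a nonzero difference of g.  Hence
D_y g = sum_i a_i(y) D_{x_i} g, and applying this to iterated differences shows
that both sides agree up to degree n - 1 when g has degree at most n + 1
([coordinates_difference]).  In particular an element g of V of bounded degree
with D_{x_i} g = 0 for all i is constant.  An element of V of degree at most n
is therefore determined by g(0) and the finitely many D_{x_i} g, which have
lower degree; by induction on the degree, the variety of f is finite
dimensional ([bounded_degree_determined]) and f has an addition formula.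

It remains to see that a generalized polynomial g with an addition formula is
a polynomial ([addition_formula_polynomial]), by induction on its degree n.
Take (x_i, a_i) as above for a finite dimensional variety containing g and
consider E g = sum_i a_i D_{x_i} g, modelled on Euler's operator.  As with
Euler's identity for homogeneous polynomials, E g - n g has degree less than n
([euler_degree]).  It still has an addition formula, so it is a polynomial by
induction; the D_{x_i} g are polynomials for the same reason, hence so is
E g, and finally so is g = (E g - (E g - n g)) / n for n > 0. *)

(** * Linear subspaces *)

Section Subspaces.
Variables (K : numFieldType) (V : lmodType K).
Implicit Types (L A : set V).

Lemma linear_subspaceZ L c u : linear_subspace L -> L u -> L (c *: u).
Proof. by move=> [L0 LP] Lu; rewrite -[c *: u]addr0; apply: LP. Qed.

Lemma linear_subspaceD L u v : linear_subspace L -> L u -> L v -> L (u + v).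
Proof. by move=> [L0 LP] Lu Lv; rewrite -[u]scale1r; apply: LP. Qed.

Lemma linear_subspaceB L u v : linear_subspace L -> L u -> L v -> L (u - v).
Proof. by move=> [L0 LP] Lu Lv; rewrite -scaleN1r addrC; apply: LP. Qed.

Lemma linear_subspace_sum L (I : Type) (r : seq I) (P : pred I) (F : I -> V) :
  linear_subspace L -> (forall i, P i -> L (F i)) ->
  L (\sum_(i <- r | P i) F i).
Proof.
move=> sL LF; elim/big_rec: _ => [|i u Pi Lu]; first exact: sL.1.
by apply: linear_subspaceD => //; apply: LF.
Qed.

Lemma linear_spanE A : linear_subspace A -> linear_span A = A.
Proof. exact: smallest_id. Qed.

Lemma span_subspace n (b : 'I_n -> V) :
  linear_subspace [set \sum_(i < n) c i *: b i | c in [set: 'I_n -> K]].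
Proof.
split=> [|t _ _ [c _ <-] [d _ <-]].
  by exists (fun=> 0) => //; rewrite big1 // => i _; rewrite scale0r.
exists (fun i => t * c i + d i) => //.
rewrite scaler_sumr -big_split /=; apply: eq_bigr => i _.
by rewrite scalerDl scalerA.
Qed.

End Subspaces.

(** * Finite dimensional spaces of functions *)

Section FunctionSpaces.
Variables (G : choiceType) (K : numFieldType).
Implicit Types (V : set (G -> K^o)) (s : seq G).

Lemma function_neq0 (g : G -> K^o) : g <> 0 -> exists z, g z != 0.
Proof.
move=> gN0; apply: contrapT => /forallNP g0; apply: gN0; apply/funext => z.
by apply/eqP; apply: contrapT => /negP; apply: g0.
Qed.

(** The form of finite dimensionality used throughout: on a subspace [V], the
evaluations at the points of [s] embed [V] into a finite power of [K].  Unlike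
a spanning family, it passes to subsets of [V] for free. *)
Definition determined_on s V :=
  forall g : G -> K^o, V g -> (forall x, x \in s -> g x = 0) -> g = 0.

(** By induction on [n], points [s] separate the span of all vectors but the
first.  If they fail for the whole span, some nonzero [w] vanishes on [s]; it
has a nonzero first coefficient, so every element of the span is a multiple of
[w] modulo the smaller span, and one more point where [w] does not vanish is
enough. *)
Lemma determined_span n (b : 'I_n -> G -> K^o) :
  exists s, determined_on s
    [set \sum_(i < n) c i *: b i | c in [set: 'I_n -> K]].
Proof.
elim: n b => [|n IHn] b.
  by exists [::] => g [c _ <-] _; rewrite big_ord0.
have [s sP] := IHn (fun i => b (lift ord0 i)).
set V := [set _ | _ in _].
have [dets|] := pselect (determined_on s V); first by exists s.
move=> /existsNP [w] /not_implyP [[d _ wE]] /not_implyP [w0 wN0].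
have [z wz] := function_neq0 wN0.
have d0N0 : d ord0 != 0.
  apply/negP => /eqP d0; apply: wN0; apply: sP => //.
  exists (fun i => d (lift ord0 i)) => //.
  by rewrite -wE big_ord_recl d0 scale0r add0r.
exists (z :: s) => g [c _ gE] g0.
pose l := c ord0 / d ord0.
have gw : g = l *: w.
  apply/subr0_eq; apply: sP.
    exists (fun i => c (lift ord0 i) - l * d (lift ord0 i)) => //.
    rewrite -gE -wE !big_ord_recl scalerDr scalerA divfK // opprD addrACA.
    rewrite subrr add0r scaler_sumr -sumrB; apply: eq_bigr => i _.
    by rewrite scalerBl scalerA.
  move=> x xs; rewrite !fctE g0 ?w0 ?scaler0 ?subr0 //.
  by rewrite in_cons xs orbT.
have /eqP : l * w z = 0 by rewrite -(g0 z) ?mem_head // gw.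
by rewrite mulf_eq0 (negPf wz) orbF gw => /eqP ->; rewrite scale0r.
Qed.

(** The pairs [(x, e)] in [ps] carry a coordinate function, the evaluation at
[x], together with its vector [e]. *)
Definition coordinates V (ps : seq (G * (G -> K^o))) :=
  (forall p, p \in ps -> V p.2) /\
  (forall g, V g -> g = \sum_(p <- ps) (g p.1 : K) *: p.2).

(** Induction on the number of points: the elements of [V] vanishing at the
first point [z] have coordinates with respect to the other points, and
subtracting [g z *: w], for some [w] in [V] normalised by [w z = 1], brings any
[g] in [V] there. *)
Lemma determined_coordinates V s :
  linear_subspace V -> determined_on s V -> exists ps, coordinates V ps.
Proof.
elim: s V => [|z s IHs] V sV dV.
  by exists [::]; split=> // g Vg; rewrite big_nil; apply: dV.
pose V0 := [set g | V g /\ g z = 0].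
have sV0 : linear_subspace V0.
  split=> [|c u v [Vu u0] [Vv v0]]; first by split=> //; apply: sV.1.
  by split; [apply: sV.2|rewrite !fctE u0 v0 scaler0 addr0].
have /(IHs _ sV0) [ps [psV psP]] : determined_on s V0.
  move=> g [Vg gz] g0; apply: dV => // x; rewrite in_cons => /orP[/eqP->//|].
  exact: g0.
have [VV0|] := pselect (V `<=` V0).
  by exists ps; split=> [p /psV []//|g /VV0 /psP].
move=> /existsNP [w'] /not_implyP [Vw' wz'].
have {}wz' : w' z != 0 by apply: contra_notN wz' => /eqP.
pose w := ((w' z)^-1 : K) *: w'.
have Vw : V w by apply: linear_subspaceZ.
have wz : w z = 1 by rewrite /w fctE /GRing.scale /= mulVf.
exists ((z, w - \sum_(p <- ps) (w p.1 : K) *: p.2) :: ps); split.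
  move=> p; rewrite in_cons => /orP[/eqP->/=|/psV[]//].
  rewrite big_seq; apply: linear_subspaceB => //.
  apply: linear_subspace_sum => // q /psV[Vq _].
  exact: linear_subspaceZ.
move=> g Vg; rewrite big_cons /=.
have /psP : V0 (g - (g z : K) *: w).
  split; first by apply: linear_subspaceB => //; apply: linear_subspaceZ.
  by rewrite !fctE wz /GRing.scale /= mulr1 subrr.
have gwE (p : G * (G -> K^o)) :
    ((g - (g z : K) *: w) p.1 : K) *: p.2 =
    (g p.1 : K) *: p.2 - (g z : K) *: ((w p.1 : K) *: p.2).
  by apply/funext => x; rewrite !fctE /GRing.scale /=; ring.
rewrite (eq_bigr _ (fun p _ => gwE p)) sumrB -scaler_sumr.
move=> /eqP; rewrite subr_eq => /eqP gE; rewrite {1}gE.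
by rewrite scalerBr addrC addrA addrAC.
Qed.

Lemma coordinates_finite_dimensional V ps :
  linear_subspace V -> coordinates V ps -> finite_dimensional V.
Proof.
move=> sV [psV psP]; exists (size ps), (fun i => (tnth (in_tuple ps) i).2).
apply/seteqP; split=> [g Vg|g [c _ <-]].
  exists (fun i => g (tnth (in_tuple ps) i).1) => //.
  by rewrite -(big_tnth _ _ ps xpredT (fun p => (g p.1 : K) *: p.2)) -psP.
apply: linear_subspace_sum => // i _; apply: linear_subspaceZ => //.
by apply: psV; apply: mem_tnth.
Qed.

End FunctionSpaces.

(** * Differences and degree *)

Section Differences.
Variables (G : zmodType) (K : numFieldType).
Implicit Types (f g h : G -> K^o) (V : set (G -> K^o)) (y z : G).

Lemma difference_linear y (c : K) g h :
  difference y (c *: g + h) = c *: difference y g + difference y h.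
Proof.
by apply/funext => x; rewrite /difference !fctE /GRing.scale /=; ring.
Qed.

Lemma difference0 y : difference y (0 : G -> K^o) = 0.
Proof. by apply/funext => x; rewrite /difference subrr. Qed.

Lemma differenceZ y (c : K) g : difference y (c *: g) = c *: difference y g.
Proof. by rewrite -[c *: g]addr0 difference_linear difference0 addr0. Qed.

Lemma differenceB y g h :
  difference y (g - h) = difference y g - difference y h.
Proof. by apply/funext => x; rewrite /difference !fctE; ring. Qed.

Lemma difference_sum y (I : Type) (r : seq I) (F : I -> G -> K^o) :
  difference y (\sum_(i <- r) F i) = \sum_(i <- r) difference y (F i).
Proof.
apply/funext => x; rewrite /difference !fct_sumE -sumrB.
by apply: eq_bigr.
Qed.

Lemma differenceC y z g :
  difference y (difference z g) = difference z (difference y g).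
Proof.
by apply/funext => x; rewrite /difference [x + z + y]addrAC; ring.
Qed.

Lemma invariant_difference V y g :
  linear_subspace V -> translation_invariant V -> V g -> V (difference y g).
Proof. by move=> sV tV Vg; apply: (linear_subspaceB sV) => //; apply: tV. Qed.

(** The shift by one puts the zero function below the constants.  Quantifying over one difference at a time makes inductions on the
degree structural. *)
Fixpoint degree_lt n g : Prop :=
  if n is n'.+1 then forall y, degree_lt n' (difference y g) else g = 0.

Lemma degree_lt_subspace n : linear_subspace (degree_lt n).
Proof.
elim: n => [|n [IH0 IHn]]; split=> //=.
- by move=> c u v -> ->; rewrite scaler0 addr0.
- by move=> y; rewrite difference0.
- by move=> c u v du dv y; rewrite difference_linear; apply: IHn.
Qed.

Lemma degree_ltS n g : degree_lt n g -> degree_lt n.+1 g.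
Proof.
elim: n g => [g -> y /=|n IHn g dg y]; first exact: difference0.
exact: IHn.
Qed.

Lemma degree_lt_difference n y g :
  degree_lt n g -> degree_lt n (difference y g).
Proof. by move=> /degree_ltS; apply. Qed.

Lemma degree_ltP n g : degree_lt n g <->
  forall ys : seq G, size ys = n -> foldr (@difference G K) g ys = 0.
Proof.
elim: n g => [|n IHn] g /=.
  by split=> [-> [|//]|g0]; [|exact: (g0 [::])].
split=> [dg|g0 y]; last first.
  apply/IHn => s sn.
  by rewrite -[RHS](g0 (rcons s y)) ?foldr_rcons ?size_rcons ?sn.
elim/last_ind => [//|s y _]; rewrite size_rcons foldr_rcons => -[].
by apply/IHn: s.
Qed.

Lemma generalized_polynomial_degree g :
  generalized_polynomial g -> exists n, degree_lt n g.
Proof.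
move=> [n gn]; exists n.+1; apply/degree_ltP => ys ysn.
exact: (gn (Tuple (introT eqP ysn))).
Qed.

Lemma degree_lt1 g : degree_lt 1 g -> g = cst (g 0).
Proof.
move=> g0; apply/funext => x.
by have /(congr1 (@^~ 0)) /= := g0 x; rewrite /difference add0r => /subr0_eq.
Qed.

Lemma degree_lt2_additive g :
  degree_lt 2 g -> additive_function (g - cst (g 0)).
Proof.
move=> g0 x y.
have /(congr1 (@^~ 0)) /= := g0 x y; rewrite /difference !add0r [y + x]addrC.
rewrite !fctE => /subr0_eq gE.
by apply/subr0_eq; rewrite -[RHS](subrr (g y - g 0)) -{1}gE; ring.
Qed.

End Differences.

(** * Varieties *)

Section Varieties.
Variables (G : zmodType) (K : numFieldType).
Implicit Types (f g : G -> K^o) (V : set (G -> K^o)).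

Lemma variety_of_subspace f : linear_subspace (variety_of f).
Proof.
split=> [|c u v fu fv] W [vW fW]; have [sW _ _] := vW; first exact: sW.1.
exact: sW.2 (fu W (conj vW fW)) (fv W (conj vW fW)).
Qed.

Lemma variety_of_translation f : translation_invariant (variety_of f).
Proof.
by move=> y g fg W [vW fW]; have [_ tW _] := vW; exact: tW (fg W (conj vW fW)).
Qed.

Lemma variety_of_id f : variety_of f f.
Proof. by move=> W [_ fW]; apply: fW. Qed.

Lemma variety_of_min f V : is_variety V -> V f -> variety_of f `<=` V.
Proof. by move=> vV Vf; apply: smallest_sub => // _ ->. Qed.

Lemma eval_continuous (x : G) :
  continuous ((fun g => g x) : {ptws G -> K^o} -> K^o).
Proof. exact: (@proj_continuous G (fun=> K^o) x). Qed.

Lemma closed_zeros (I : Type) (phi : I -> {ptws G -> K^o} -> K^o) :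
  (forall i, continuous (phi i)) -> closed [set g | forall i, phi i g = 0].
Proof.
move=> phiC; rewrite (_ : [set g | _] = \bigcap_i (phi i @^-1` [set 0])).
  apply: closed_bigI => i _; apply: preimage_closed.
    by move=> g _; apply: phiC.
  exact: (accessible_closed_set1 (hausdorff_accessible (@norm_hausdorff _ _))).
by apply/seteqP; split=> [g g0 i _|g g0 i]; [exact: g0|apply: g0].
Qed.

(** Closed because an iterated difference at a point is a linear combination
of finitely many evaluations.  Hence a degree bound on [f] holds on the whole
variety of [f]. *)
Lemma degree_lt_variety n : is_variety (@degree_lt G K n).
Proof.
split; first exact: degree_lt_subspace.
  move=> y g dg.
  rewrite (_ : (fun _ => _) = g + difference y g); last first.
    by apply/funext => x; rewrite fctE /difference addrC subrK.
  apply: (linear_subspaceD (degree_lt_subspace _ _ n) dg).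
  exact: degree_lt_difference.
have phiC ys x : continuous
    ((fun g => foldr (@difference G K) g ys x) : {ptws G -> K^o} -> K^o).
  elim: ys x => [|y ys IHys] x; first exact: eval_continuous.
  move=> g; pose phi z (h : {ptws G -> K^o}) : K^o :=
    foldr (@difference G K) h ys z.
  exact: (@cvgB K K^o _ _ _ (phi (x + y)) (phi x) _ _ (IHys _ g) (IHys _ g)).
rewrite (_ : degree_lt _ = [set g |
  forall i : {ys : seq G | size ys = n} * G,
    foldr (@difference G K) g (sval i.1) i.2 = 0]).
  by apply: closed_zeros => i; apply: phiC.
apply/seteqP; split=> g /=.
  by move=> /degree_ltP dg [[ys ysn] x] /=; rewrite dg.
move=> g0; apply/degree_ltP => ys ysn; apply/funext => x.
exact: (g0 (exist _ ys ysn, x)).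
Qed.

End Varieties.

(** * Finitely many additive functions control all differences *)

Section AdditiveFunctions.
Variables (G : zmodType) (K : numFieldType).
Implicit Types (f g h a : G -> K^o) (V : set (G -> K^o)) (y z : G).
Implicit Types (ps : seq (G * (G -> K^o))).

Lemma difference_additive y a :
  additive_function a -> difference y a = cst (a y).
Proof. by move=> aD; apply/funext => x; rewrite /difference aD addrC addKr. Qed.

Lemma additive_subspace V : linear_subspace V ->
  linear_subspace [set a | additive_function a /\ V a].
Proof.
move=> sV; split; first by split; [move=> x y; rewrite addr0|exact: sV.1].
move=> c a b [aD Va] [bD Vb]; split; last exact: sV.2.
by move=> x y; rewrite !fctE aD bD scalerDr addrACA.
Qed.

(** For [g] of degree at most 1 ([n = 0]) this is an equality: [g - cst (g 0)]
is an additive function in [V], and its coordinates are the constant values of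
the differences of [g].  The general case follows by taking differences. *)
Lemma coordinates_difference V ps n g y :
  linear_subspace V -> translation_invariant V ->
  coordinates [set a | additive_function a /\ V a] ps ->
  V g -> degree_lt n.+2 g ->
  degree_lt n (difference y g - \sum_(p <- ps) (p.2 y : K) *: difference p.1 g).
Proof.
move=> sV tV [psA psP].
elim: n g => [|n IHn] g Vg dg; last first.
  move=> z; rewrite differenceB difference_sum.
  have := IHn _ (invariant_difference z sV tV Vg) (dg z).
  rewrite differenceC (_ : \sum_(p <- ps) (p.2 y : K) *: _ =
    \sum_(p <- ps) difference z ((p.2 y : K) *: difference p.1 g)) //.
  by apply: eq_bigr => p _; rewrite differenceZ differenceC.
pose a := g - cst (g 0).
have aD : additive_function a := degree_lt2_additive dg.
have daE z : difference z g = cst (a z).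
  rewrite -(difference_additive z aD) differenceB.
  suff -> : difference z (cst (g 0) : G -> K^o) = 0 by rewrite subr0.
  by apply/funext => x; rewrite /difference subrr.
have Va : V a.
  have [-> |a0] := pselect (a = 0); first exact: sV.1.
  have [z az] := function_neq0 a0.
  (* The nonzero constant D_z g puts all constants into V. *)
  apply: linear_subspaceB => //.
  rewrite (_ : cst _ = (g 0 / a z : K) *: difference z g).
    exact: linear_subspaceZ sV (invariant_difference z sV tV Vg).
  by apply/funext => x; rewrite daE; apply/esym/(divfK az).
have aE := psP a (conj aD Va).
apply/funext => x; rewrite !fctE fct_sumE daE /=.
apply/eqP; rewrite subr_eq0 {1}aE fct_sumE; apply/eqP/eq_bigr => p _.
by rewrite !fctE daE /GRing.scale /= mulrC.
Qed.

(** By [coordinates_difference], if [difference p.1 g = 0] for all [p] in [ps]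
then the degree of [g] drops until [g] is constant.  The points are chosen so
that vanishing of [g] there makes each [difference p.1 g] vanish on the points
obtained for the smaller degree; the point [0] takes care of the constants. *)
Lemma bounded_degree_determined V ps n :
  linear_subspace V -> translation_invariant V ->
  coordinates [set a | additive_function a /\ V a] ps ->
  exists s, determined_on s [set g | V g /\ degree_lt n g].
Proof.
move=> sV tV cA; elim: n => [|n [s sP]]; first by exists [::] => g [].
exists (0 :: s ++ [seq x + p.1 | x <- s, p <- ps]) => g [Vg dg] g0.
have dg0 p : p \in ps -> difference p.1 g = 0.
  move=> pps; apply: sP.
    by split; [exact: (invariant_difference p.1 sV tV Vg)|exact: dg].
  move=> x xs; rewrite /difference (g0 x) ?in_cons ?mem_cat ?xs ?orbT //.
  rewrite g0 ?subrr // in_cons mem_cat; apply/orP; right; apply/orP; right.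
  exact: (allpairs_f (fun x p => x + p.1)).
have {}dg0 : degree_lt 1 g.
  elim: n dg {sP} => // n IHn dg; apply: IHn => y.
  have := coordinates_difference y sV tV cA Vg dg.
  by rewrite big_seq big1 ?subr0 // => p /dg0 ->; rewrite scaler0.
by rewrite (degree_lt1 dg0) g0 ?mem_head.
Qed.

(** When the [p.2] are coordinate functions on a vector space and the [p.1] the
dual basis, this is Euler's operator with differences in place of partial
derivatives. *)
Definition euler (ps : seq (G * (G -> K^o))) g : G -> K^o :=
  \sum_(p <- ps) (fun x => p.2 x * difference p.1 g x).

Lemma eulerE ps g x :
  euler ps g x = \sum_(p <- ps) p.2 x * difference p.1 g x.
Proof. by rewrite /euler fct_sumE. Qed.

(** The Leibniz rule for an additive factor,
[difference y (a * v) x = a y * v (x + y) + a x * difference y v x], summed over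
[ps].  The terms are arranged for [euler_degree]: the first line is the same
expression for [difference y g] and [c], the others have lower degree. *)
Lemma difference_euler ps y (c : K) g :
  (forall p, p \in ps -> additive_function p.2) ->
  difference y (euler ps g - (1 + c) *: g) =
  (euler ps (difference y g) - c *: difference y g)
  - (difference y g - \sum_(p <- ps) (p.2 y : K) *: difference p.1 g)
  + \sum_(p <- ps) (p.2 y : K) *: difference p.1 (difference y g).
Proof.
move=> psD; apply/funext => x.
have fctZ (F : G * (G -> K^o) -> G -> K^o) :
    (\sum_(p <- ps) (p.2 y : K) *: F p) x = \sum_(p <- ps) p.2 y * F p x.
  by rewrite fct_sumE.
rewrite !addrfctE !opprfctE !fctZ !eulerE.
have -> : difference y (euler ps g - (1 + c) *: g) x =
  (\sum_(p <- ps) p.2 x * difference p.1 (difference y g) x +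
   \sum_(p <- ps) p.2 y * difference p.1 g x +
   \sum_(p <- ps) p.2 y * difference p.1 (difference y g) x)
  - (1 + c) * difference y g x.
  rewrite -!big_split /=.
  transitivity (\sum_(p <- ps) p.2 (x + y) * difference p.1 g (x + y)
    - \sum_(p <- ps) p.2 x * difference p.1 g x - (1 + c) * difference y g x).
    by rewrite -!eulerE /difference !fctE /GRing.scale /=; ring.
  rewrite -sumrB; congr (_ - _); apply: eq_big_seq => p pps.
  rewrite psD // differenceC /difference.
  have prodE (a b u v w t : K) : (a + b) * (u - v) - a * (w - t) =
    a * (u - v - (w - t)) + b * (w - t) + b * (u - v - (w - t)) by ring.
  exact: prodE.
have collectE (u v w t e : K) :
  u + v + w - (1 + t) * e = u - t * e - (e - v) + w by ring.
exact: collectE.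
Qed.

(** Analogue of Euler's identity: on the homogeneous part of degree [n.+1] the
operator acts as multiplication by [n.+1].  The last hypothesis replaces the
chain rule, and is inherited by the differences of [g]. *)
Lemma euler_degree ps n g :
  (forall p, p \in ps -> additive_function p.2) ->
  degree_lt n.+2 g ->
  (forall y,
     degree_lt n
       (difference y g - \sum_(p <- ps) (p.2 y : K) *: difference p.1 g)) ->
  degree_lt n.+1 (euler ps g - n.+1%:R *: g).
Proof.
move=> psD; elim: n g => [|n IHn] g dg gE y; rewrite mulrS difference_euler //.
  rewrite gE subr0 scale0r subr0 [X in _ + X]big1 => [|p _]; last first.
    by rewrite dg scaler0.
  rewrite addr0; apply/funext => x; rewrite eulerE big1 // => p _.
  by rewrite dg mulr0.
have sd := @degree_lt_subspace G K n.+1.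
apply: (linear_subspaceD sd); first apply: (linear_subspaceB sd) => //.
  apply: IHn => // z.
  have := gE z y; rewrite differenceB difference_sum differenceC.
  rewrite (_ : \sum_(p <- ps) difference _ _ =
    \sum_(p <- ps) (p.2 z : K) *: difference p.1 (difference y g)) //.
  by apply: eq_bigr => p _; rewrite differenceZ differenceC.
apply: (linear_subspace_sum _ sd) => p _; apply: (linear_subspaceZ _ sd).
exact: dg.
Qed.

End AdditiveFunctions.

(** * Addition formulas *)

Section AdditionFormulas.
Variables (G : zmodType) (K : numFieldType).
Implicit Types (f g : G -> K^o) (V : set (G -> K^o)) (y : G).

(** The Levi-Civita functional equation.  It is equivalent to the translates of
[f] spanning a finite dimensional space, but sums and products preserve it by
direct computation. *)
Definition has_addition_formula f := exists us : seq ((G -> K^o) * (G -> K^o)),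
  forall x y, f (x + y) = \sum_(u <- us) u.1 x * u.2 y.

Lemma addition_formula_cst (c : K) : has_addition_formula (cst c).
Proof. by exists [:: (cst c, cst 1)] => x y; rewrite big_seq1 mulr1. Qed.

Lemma addition_formula_additive f :
  additive_function f -> has_addition_formula f.
Proof.
move=> fD; exists [:: (f, cst 1); (cst 1, f)] => x y.
by rewrite big_cons big_seq1 mulr1 mul1r fD.
Qed.

Lemma addition_formulaD f g : has_addition_formula f ->
  has_addition_formula g -> has_addition_formula (f + g).
Proof.
move=> [us fE] [vs gE]; exists (us ++ vs) => x y.
by rewrite big_cat -fE -gE.
Qed.

Lemma addition_formulaM f g : has_addition_formula f ->
  has_addition_formula g -> has_addition_formula (fun x => f x * g x).
Proof.
move=> [us fE] [vs gE].
exists [seq ((fun x => u.1 x * v.1 x), (fun y => u.2 y * v.2 y))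
       | u <- us, v <- vs] => x y.
rewrite big_allpairs_dep /= fE gE big_distrlr /=.
by apply: eq_bigr => u _; apply: eq_bigr => v _; rewrite mulrACA.
Qed.

Lemma addition_formula_subspace : linear_subspace has_addition_formula.
Proof.
split=> [|c f g sf sg]; first exact: addition_formula_cst.
exact: addition_formulaD (addition_formulaM (addition_formula_cst c) sf) sg.
Qed.

Lemma addition_formula_difference y f :
  has_addition_formula f -> has_addition_formula (difference y f).
Proof.
move=> [us fE].
exists [seq (u.1, difference y u.2) | u <- us] => x z.
rewrite big_map /difference -addrA !fE -sumrB.
by apply: eq_bigr => u _; rewrite mulrBr.
Qed.

Lemma addition_formula_exp f k :
  has_addition_formula f -> has_addition_formula (fun x => f x ^+ k).
Proof.
move=> sf; elim: k => [|k IHk]; first exact: addition_formula_cst.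
rewrite (_ : (fun x => _) = fun x => f x * f x ^+ k).
  exact: addition_formulaM.
by apply/funext => x; rewrite exprS.
Qed.

Lemma addition_formula_prod (I : Type) (r : seq I) (F : I -> G -> K^o) :
  (forall i, has_addition_formula (F i)) ->
  has_addition_formula (fun x => \prod_(i <- r) F i x).
Proof.
move=> sF; elim: r => [|i r IHr].
  rewrite (_ : (fun x => _) = cst 1); first exact: addition_formula_cst.
  by apply/funext => x; rewrite big_nil.
rewrite (_ : (fun x => _) = fun x => F i x * \prod_(j <- r) F j x).
  exact: addition_formulaM.
by apply/funext => x; rewrite big_cons.
Qed.

Lemma polynomial_addition_formula f :
  polynomial_function f -> has_addition_formula f.
Proof.
move=> [n [a [P [aD fE]]]].
rewrite (_ : f = \sum_(m <- mpoly.msupp P) (mpoly.mcoeff m P *: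
    (fun x => \prod_i a i x ^+ mpoly.fun_of_multinom m i : K^o))); last first.
  by apply/funext => x; rewrite fE mpoly.mevalE fct_sumE.
have sS := addition_formula_subspace; apply: (linear_subspace_sum _ sS) => m _.
apply: (linear_subspaceZ _ sS); apply: addition_formula_prod => i.
exact/addition_formula_exp/addition_formula_additive.
Qed.

(** Expand the translate of [f] by [y] in coordinates of [V]. *)
Lemma determined_addition_formula V s f :
  linear_subspace V -> translation_invariant V -> determined_on s V ->
  V f -> has_addition_formula f.
Proof.
move=> sV tV dV Vf; have [ps [_ psP]] := determined_coordinates sV dV.
exists [seq (p.2, fun y => f (p.1 + y)) | p <- ps] => x y.
rewrite big_map -[LHS]/((fun x => f (x + y)) x) (psP _ (tV y f Vf)) fct_sumE.
by apply: eq_bigr => p _; rewrite mulrC.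
Qed.

(** The variety consists of the functions all of whose translates lie in the
span [S] of the left factors.  It is closed because coordinates of [S] turn
membership in [S] into linear equations between values at finitely many
points. *)
Lemma addition_formula_variety f : has_addition_formula f ->
  exists V s, [/\ is_variety V, V f & determined_on s V].
Proof.
move=> [us fE].
pose b (i : 'I_(size us)) := (tnth (in_tuple us) i).1.
pose S := [set \sum_i c i *: b i | c in [set: 'I_(size us) -> K]].
have sS : linear_subspace S := span_subspace b.
have [s dS] := determined_span b; rewrite -/S in dS.
have [ps cS] := determined_coordinates sS dS.
exists [set g | forall y, S (fun x => g (x + y))], s; split; first split.
- split=> [y|c u v Su Sv y]; first exact: sS.1.
  exact: sS.2 _ _ _ (Su y) (Sv y).
- move=> y g Sg z /=.
  by have := Sg (z + y); congr S; apply/funext => x; rewrite addrA.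
- rewrite (_ : [set g | _] = [set g | forall i : G * G,
    g (i.2 + i.1) - \sum_(p <- ps) g (p.1 + i.1) * p.2 i.2 = 0]); last first.
    apply/seteqP; split=> g /=.
      move=> Sg [y x] /=; have /(congr1 (@^~ x)) := cS.2 _ (Sg y).
      by rewrite fct_sumE /= => ->; rewrite subrr.
    move=> g0 y.
    rewrite (_ : (fun x => _) = \sum_(p <- ps) (g (p.1 + y) : K) *: p.2).
      rewrite big_seq; apply: (linear_subspace_sum _ sS) => p pps.
      exact: (linear_subspaceZ _ sS (cS.1 _ pps)).
    by apply/funext => x; rewrite fct_sumE; apply/subr0_eq; exact: (g0 (y, x)).
  apply: closed_zeros => -[y x] g.
  pose phi (p : G * (G -> K^o)) (h : {ptws G -> K^o}) : K^o :=
    h (p.1 + y) * p.2 x.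
  have phiC : continuous (fun h => \sum_(p <- ps) phi p h).
    refine (@continuous_big K^o _ +%R 0 xpredT (@add_continuous K^o)
      {ptws G -> K^o} ps phi _) => p _ h.
    have evC := @eval_continuous G K (p.1 + y) h.
    exact: (cvgMr_tmp (b := p.2 x) evC).
  exact: (@cvgB K K^o _ _ _ (fun h : {ptws G -> K^o} => h (x + y))
    _ _ _ (@eval_continuous G K (x + y) g) (phiC g)).
- move=> y; exists (fun i => (tnth (in_tuple us) i).2 y) => //.
  apply/funext => x; rewrite fct_sumE fE [RHS]big_tnth.
  by apply: eq_bigr => i _; rewrite /b mulrC.
- move=> g Sg; apply: dS.
  by have := Sg 0; congr S; apply/funext => x; rewrite addr0.
Qed.

End AdditionFormulas.

(** * Polynomials *)

Section PolynomialFunctions.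
Variables (G : zmodType) (K : numFieldType).
Implicit Types (f g : G -> K^o).

Lemma polynomial_cst (c : K) : polynomial_function (cst c : G -> K^o).
Proof.
exists 0%N, (fun=> 0), (mpoly.mpolyC 0 c); split=> [[]//|x].
by rewrite mpoly.mevalC.
Qed.

Lemma polynomial_additive f : additive_function f -> polynomial_function f.
Proof.
move=> fD; exists 1%N, (fun=> f), (mpoly.mpolyX K (mpoly.mnm1 ord0)).
by split=> // x; rewrite mpoly.mevalXU.
Qed.

Lemma polynomial_common_generators f g :
  polynomial_function f -> polynomial_function g ->
  exists (n : nat) (a : 'I_n -> G -> K^o) (P Q : mpoly.mpoly n K),
    [/\ forall i, additive_function (a i),
        forall x, f x = mpoly.meval (fun i => a i x) P
      & forall x, g x = mpoly.meval (fun i => a i x) Q].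
Proof.
move=> [n [a [P [aD fE]]]] [m [b [Q [bD gE]]]].
pose X (i : 'I_(n + m)) := mpoly.mpolyX K (mpoly.mnm1 i).
exists (n + m)%N,
  (fun i => match fintype.split i with inl j => a j | inr j => b j end),
  (mpoly.comp_mpoly [tuple X (lshift m i) | i < n] P),
  (mpoly.comp_mpoly [tuple X (rshift n i) | i < m] Q).
split=> [i|x|x]; first by case: (fintype.split i).
- rewrite fE mpoly.comp_mpoly_meval; apply: mpoly.meval_eq => i.
  by rewrite tnth_mktuple mpoly.mevalXU (unsplitK (inl i)).
- rewrite gE mpoly.comp_mpoly_meval; apply: mpoly.meval_eq => i.
  by rewrite tnth_mktuple mpoly.mevalXU (unsplitK (inr i)).
Qed.

Lemma polynomialD f g :
  polynomial_function f -> polynomial_function g -> polynomial_function (f + g).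
Proof.
move=> pf pg.
have [n [a [P [Q [aD fE gE]]]]] := polynomial_common_generators pf pg.
by exists n, a, (P + Q); split=> // x; rewrite mpoly.mevalD -fE -gE.
Qed.

Lemma polynomialM f g : polynomial_function f -> polynomial_function g ->
  polynomial_function (fun x => f x * g x).
Proof.
move=> pf pg.
have [n [a [P [Q [aD fE gE]]]]] := polynomial_common_generators pf pg.
by exists n, a, (P * Q); split=> // x; rewrite mpoly.mevalM -fE -gE.
Qed.

Lemma polynomial_subspace : linear_subspace (@polynomial_function G K).
Proof.
split=> [|c f g pf pg]; first exact: polynomial_cst.
exact: polynomialD (polynomialM (polynomial_cst c) pf) pg.
Qed.

(** In degree at most [n.+1], with coordinates of the additive functions of a
finite dimensional variety containing [f], both [euler ps f] and its difference
[h] with [n.+1%:R *: f] are polynomials by induction.  The induction runs over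
all functions with an addition formula because [h] need not lie in the variety
of [f]. *)
Lemma addition_formula_polynomial n f :
  has_addition_formula f -> degree_lt n f -> polynomial_function f.
Proof.
elim: n f => [|[|n] IHn] f sf df.
- by rewrite df; apply: polynomial_cst.
- by rewrite (degree_lt1 df); apply: polynomial_cst.
have aS := @addition_formula_subspace G K; have pS := polynomial_subspace.
have [V [s [[sV tV _] Vf dV]]] := addition_formula_variety sf.
have [ps cA] : exists ps, coordinates [set a | additive_function a /\ V a] ps.
  apply: (@determined_coordinates _ _ _ s (additive_subspace sV)).
  by move=> a [_ Va]; apply: dV.
have psD p : p \in ps -> additive_function p.2 by case/cA.1.
pose h := euler ps f - n.+1%:R *: f.
have dh : degree_lt n.+1 h.
  apply: euler_degree => // y.
  exact: coordinates_difference sV tV cA Vf df.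
have se : has_addition_formula (euler ps f).
  rewrite /euler big_seq; apply: (linear_subspace_sum _ aS) => p pps.
  apply: addition_formulaM; first exact/addition_formula_additive/psD.
  exact: addition_formula_difference.
have pe : polynomial_function (euler ps f).
  rewrite /euler big_seq; apply: (linear_subspace_sum _ pS) => p pps.
  apply: polynomialM; first exact/polynomial_additive/psD.
  by apply: IHn; [exact: addition_formula_difference|exact: df].
have ph : polynomial_function h.
  by apply: IHn dh; apply: (linear_subspaceB aS se) (linear_subspaceZ _ aS _).
rewrite (_ : f = n.+1%:R^-1 *: (euler ps f - h)).
  exact: linear_subspaceZ pS (linear_subspaceB pS pe ph).
by rewrite subKr scalerA mulVf ?scale1r // pnatr_eq0.
Qed.

End PolynomialFunctions.

(** * The characterisation *)

Section Characterisation.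
Variables (G : zmodType) (K : numFieldType).
Implicit Types (f : G -> K^o).

Lemma polynomial_iff_finite_dimensional f : generalized_polynomial f ->
  polynomial_function f <->
  finite_dimensional
    (linear_span [set a : G -> K^o | additive_function a /\ variety_of f a]).
Proof.
move=> /generalized_polynomial_degree [n dn].
set A := [set a | _].
have sA : linear_subspace A := additive_subspace (@variety_of_subspace _ _ f).
rewrite linear_spanE //; split.
  move=> /polynomial_addition_formula/addition_formula_variety.
  move=> [V [s [vV Vf dV]]].
  have [ps cA] : exists ps, coordinates A ps.
    apply: (determined_coordinates sA (s := s)) => a [_ fa].
    exact/dV/(variety_of_min vV Vf).
  exact: coordinates_finite_dimensional sA cA.
move=> [m [b AE]]; have [s dA] := determined_span b; rewrite -AE in dA.
have [ps cA] := determined_coordinates sA dA.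
have sf := @variety_of_subspace _ _ f.
have tf := @variety_of_translation _ _ f.
have [t dt] := bounded_degree_determined n sf tf cA.
apply: (addition_formula_polynomial _ dn).
have ff := @variety_of_id _ _ f.
apply: (determined_addition_formula (s := t) sf tf _ ff) => g fg; apply: dt.
by split=> //; exact: variety_of_min (degree_lt_variety _ _ n) dn _ fg.
Qed.

End Characterisation.

Theorem corollary4 (R : realType) (G : zmodType) (f : G -> R[i]^o)
    (hf : generalized_polynomial f) :
  polynomial_function f <->
  finite_dimensional
    (linear_span [set a : G -> R[i]^o | additive_function a /\ variety_of f a]).
Proof. exact: polynomial_iff_finite_dimensional. Qed.
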